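(* Let $\mathbb{Z}/2$ act on $\mathbb{Z}$ via $n\mapsto -n$. Then for $i>0$, $$H_i^{\mathbb{Z}/2}(\mathbb{Z};\mathbb{Z})\cong\begin{cases}\mathbb{Z}/2 & i\ \text{odd}\\ 0 & i\ \text{even}.\end{cases}$$
   Context: For a finite group $Q$ acting on a group $G$ by automorphisms, $C_\bullet(G)$ is the (unnormalized) bar complex: $C_i(G)$ is the free abelian group on symbols $[g_1|\cdots|g_i]$ with $g_j\in G$, with boundary $d[g_1|\cdots|g_i]=[g_2|\cdots|g_i]+\sum_{k=1}^{i-1}(-1)^k[g_1|\cdots|g_kg_{k+1}|\cdots|g_i]+(-1)^i[g_1|\cdots|g_{i-1}]$ (with $g_kg_{k+1}$ the group operation of $G$, which is addition for $G=\mathbb{Z}$). $Q$ acts on it by $q[g_1|\cdots|g_i]=[q(g_1)|\cdots|q(g_i)]$, and $C_\bullet(G)^Q$ is the subcomplex of $Q$-invariant chains. $H_\bullet^Q(G;\mathbb{Z})$ is the homology of $C_\bullet(G)^Q$. *)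

(* Defs.v *)
From HB Require Import structures.
From mathcomp Require Import all_boot all_order all_algebra all_fingroup.
From mathcomp Require Import ring_quotient freeg boolp zify.

Set Implicit Arguments.
Unset Strict Implicit.
Unset Printing Implicit Defensive.

Import GRing.Theory.

Local Open Scope ring_scope.

Definition zmod_isog (U V : zmodType) : Prop :=
  exists f : {additive U -> V}, bijective f.

Record chain_complex := ChainComplex {
  chain :> nat -> zmodType;
  boundary : forall n, {additive chain n.+1 -> chain n};
  boundaryK : forall n (c : chain n.+2), boundary n (boundary n.+1 c) = 0
}.

Section Homology.

Variable C : chain_complex.

Definition is_cycle (n : nat) : {pred C n} :=
  if n is m.+1 then fun c : C m.+1 => boundary C m c == 0 else fun=> true.

Fact is_cycle_zmod_closed n : zmod_closed (@is_cycle n).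
Proof.
case: n => [|n]; split=> //; first by rewrite unfold_in /= raddf0.
by move=> x y; rewrite !unfold_in /= raddfB => /eqP-> /eqP->; rewrite subr0.
Qed.

HB.instance Definition _ n :=
  GRing.isZmodClosed.Build (C n) (@is_cycle n) (@is_cycle_zmod_closed n).

Record cycle_group (n : nat) := Cycle {
  cycle_val :> C n;
  _ : cycle_val \in @is_cycle n
}.

HB.instance Definition _ n := [isSub for @cycle_val n].
HB.instance Definition _ n := [Choice of cycle_group n by <:].
HB.instance Definition _ n := [SubChoice_isSubZmodule of cycle_group n by <:].

(* Being a boundary is not decidable in general, hence the use of asbool. *)
Definition is_boundary (n : nat) : {pred cycle_group n} :=
  fun z => `[< exists c : C n.+1, boundary C n c = val z >].

Fact is_boundary_zmod_closed n : zmod_closed (@is_boundary n).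
Proof.
split=> [|x y]; rewrite ?unfold_in.
  by apply/asboolP; exists 0; rewrite !raddf0.
move=> /asboolP[a da] /asboolP[b db]; apply/asboolP; exists (a - b).
by rewrite !raddfB da db.
Qed.

HB.instance Definition _ n :=
  GRing.isZmodClosed.Build (cycle_group n) (@is_boundary n)
    (@is_boundary_zmod_closed n).

Definition homology (n : nat) : zmodType := {ideal_quot @is_boundary n}.

End Homology.

Section BarComplex.

Variable G : groupType.

Definition bar_chain (n : nat) : lmodType int := {freeg n.-tuple G}.

(* In the three faces of t = [g_1|...|g_(n+1)] below, the entry g_(j+1) is
   nth 1 t j; all indices are in range, so the default 1 is never used.      *)
Definition bar_drop_first n (t : n.+1.-tuple G) : n.-tuple G :=
  [tuple nth 1%g t j.+1 | j < n].

Definition bar_drop_last n (t : n.+1.-tuple G) : n.-tuple G :=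
  [tuple nth 1%g t j | j < n].

Definition bar_mul_at n (k : 'I_n) (t : n.+1.-tuple G) : n.-tuple G :=
  [tuple if (j < k)%N then nth 1%g t j
         else if j == k then (nth 1%g t j * nth 1%g t j.+1)%g
         else nth 1%g t j.+1 | j < n].

Definition bar_bd_gen n (t : n.+1.-tuple G) : bar_chain n :=
  << bar_drop_first t >>
  + \sum_(k < n) << (-1) ^+ k.+1 *g bar_mul_at k t >>
  + << (-1) ^+ n.+1 *g bar_drop_last t >>.

Definition bar_bd n : bar_chain n.+1 -> bar_chain n := fglift (@bar_bd_gen n).

HB.instance Definition _ n :=
  GRing.isZmodMorphism.Build (bar_chain n.+1) (bar_chain n) (@bar_bd n)
    (lift_is_additive (@bar_bd_gen n)).

Lemma bar_bdU n m (t : n.+1.-tuple G) :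
  bar_bd << m *g t >> = m *: bar_bd_gen t.
Proof. exact: liftU. Qed.

(* The faces written uniformly, on sequences indexed by nat: k = 0 drops the
   first entry of an (n+1)-tuple, k = n + 1 the last one.                    *)
Definition seq_face (k : nat) (u : nat -> G) (j : nat) : G :=
  if (j.+1 < k)%N then u j
  else if j.+1 == k then (u j * u j.+1)%g else u j.+1.

Definition bar_face n (k : nat) (t : n.+1.-tuple G) : n.-tuple G :=
  [tuple seq_face k (nth 1%g t) j | j < n].

Lemma seq_face_comm k l u : (k <= l)%N ->
  seq_face k (seq_face l.+1 u) =1 seq_face l (seq_face k u).
Proof.
move=> kl j; rewrite /seq_face !eqSS !ltnS.
have [jk|jk|jk] := ltngtP j.+1 k; have [jl|jl|jl] := ltngtP j.+1 l;
  have [jl'|jl'|jl'] := ltngtP j.+2 l; have [jk'|jk'|jk'] := ltngtP j.+2 k;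
  have [jk''|jk''|jk''] := ltngtP j k; have [jl''|jl''|jl''] := ltngtP j l;
  rewrite ?mulgA //; exfalso; lia.
Qed.

Lemma bar_face_comm n k l (t : n.+2.-tuple G) : (k <= l <= n.+1)%N ->
  bar_face k (bar_face l.+1 t) = bar_face l (bar_face k t).
Proof.
move=> /andP[kl ln]; apply: eq_from_tnth => j; rewrite !tnth_mktuple.
have nthE m (p : nat) : (p <= n)%N ->
  nth 1%g (bar_face m t) p = seq_face m (nth 1%g t) p.
  by move=> pn; rewrite -[p]/(nat_of_ord (Ordinal (pn : p < n.+1)%N))
                         -tnth_nth tnth_mktuple.
have faceE m m' : seq_face m (nth 1%g (bar_face m' t)) j
                = seq_face m (seq_face m' (nth 1%g t)) j.
  by have jn := ltn_ord j; rewrite /seq_face !nthE //; lia.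
by rewrite !faceE seq_face_comm.
Qed.

Lemma bar_bd_genE n (t : n.+1.-tuple G) :
  bar_bd_gen t = \sum_(k < n.+2) << (-1) ^+ k *g bar_face k t >>.
Proof.
have firstE : bar_face 0 t = bar_drop_first t.
  by apply: eq_from_tnth => j; rewrite !tnth_mktuple.
have mulE (k : 'I_n) : bar_face k.+1 t = bar_mul_at k t.
  by apply: eq_from_tnth => j; rewrite !tnth_mktuple /seq_face ltnS eqSS.
have lastE : bar_face n.+1 t = bar_drop_last t.
  by apply: eq_from_tnth => j; rewrite !tnth_mktuple /seq_face ltnS ltn_ord.
rewrite /bar_bd_gen big_ord_recl big_ord_recr /= expr0 addrA firstE lastE.
by under [in RHS]eq_bigr do rewrite mulE.
Qed.

Lemma bar_ind n (P : bar_chain n -> Prop) :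
  P 0 -> (forall c d, P c -> P d -> P (c + d)) ->
  (forall m t, P << m *g t >>) -> forall c, P c.
Proof. by move=> P0 PD PU c; rewrite -[c]freeg_sumE; apply: big_ind. Qed.

Lemma bar_bdK n (c : bar_chain n.+2) : bar_bd (bar_bd c) = 0.
Proof.
elim/bar_ind: c => [|c d IHc IHd|m t]; first by rewrite !raddf0.
  by rewrite !raddfD /= IHc IHd addr0.
rewrite bar_bdU -[m]intz scaler_int raddfMz /= bar_bd_genE raddf_sum /=.
pose a k l : bar_chain n :=
  << (-1) ^+ k * (-1) ^+ l *g bar_face l (bar_face k t) >>.
rewrite (eq_bigr (fun k : 'I_n.+3 => \sum_(l < n.+2) a k l)) => [|k _]; last first.
  rewrite bar_bdU bar_bd_genE scaler_sumr; apply: eq_bigr => l _.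
  by apply/eqP/freeg_eqP => x; rewrite coeffZ !coeffU mulrA.
rewrite (eq_bigr (fun k : 'I_n.+3 => \sum_(l < n.+2 | (k <= l)%N) a k l
   + \sum_(l < n.+2 | (l < k)%N) a k l)) => [|k _]; last first.
  rewrite (bigID (fun l : 'I_n.+2 => (k <= l)%N)) /=; congr (_ + _).
  by apply: eq_bigl => l; rewrite ltnNge.
rewrite big_split /= big_ord_recr /= [X in _ + X + _]big1 => [|l]; last first.
  by have := ltn_ord l; lia.
rewrite addr0 [X in _ + X](exchange_big_dep predT) //=.
rewrite [X in _ + X](eq_bigr (fun l : 'I_n.+2 =>
    \sum_(k < n.+2 | (l <= k)%N) a k.+1 l)) => [|l _]; last first.
  by rewrite big_mkcond big_ord_recl /= add0r -big_mkcond.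
rewrite -big_split big1 ?mul0rz //= => k _.
rewrite -big_split big1 //= => l kl; rewrite /a bar_face_comm; last first.
  by rewrite kl -ltnS ltn_ord.
by rewrite freegUD exprS mulN1r mulNr [_ ^+ l * _]mulrC subrr freegU0.
Qed.

Definition bar_complex : chain_complex := ChainComplex bar_bdK.

End BarComplex.

(* {action Q &-> G} is a right action: to x (p * q) = to (to x p) q. The left
   action it encodes is q(x) = to x q^-1; it has the same invariants.        *)
Record aut_action (Q : finGroupType) (G : groupType) := AutAction {
  aut_act :> {action Q &-> G};
  aut_actM : forall q, {morph aut_act^~ q : x y / (x * y)%g}
}.

Section InvariantComplex.

Variables (Q : finGroupType) (G : groupType) (to : aut_action Q G).

Definition bar_act n (q : Q) : bar_chain G n -> bar_chain G n :=
  fglift (fun t : n.-tuple G =>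
    << [tuple of [seq to g q | g <- t]] >> : bar_chain G n).

HB.instance Definition _ n q :=
  GRing.isZmodMorphism.Build (bar_chain G n) (bar_chain G n) (@bar_act n q)
    (lift_is_additive _).

Lemma bar_actU n q m (t : n.-tuple G) :
  bar_act q << m *g t >> = << m *g [tuple of [seq to g q | g <- t]] >>.
Proof.
rewrite /bar_act liftU; apply/eqP/freeg_eqP => x.
by rewrite coeffZ !coeffU mul1r.
Qed.

Lemma bar_act_bd n q (c : bar_chain G n.+1) :
  bar_act q (bar_bd c) = bar_bd (bar_act q c).
Proof.
elim/bar_ind: c => [|c d IHc IHd|m t]; first by rewrite !raddf0.
  by rewrite !raddfD /= IHc IHd.
rewrite bar_actU !bar_bdU -[m]intz !scaler_int raddfMz /= !bar_bd_genE.
rewrite raddf_sum; congr (_ *~ _); apply: eq_bigr => k _ /=; rewrite bar_actU.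
congr (Freeg [:: (_, _)]); apply: eq_from_tnth => j.
rewrite tnth_map !tnth_mktuple /seq_face.
rewrite !(nth_map 1%g) ?size_tuple ?ltnS ?(ltnW (ltn_ord j)) //.
by case: ifP => // _; case: ifP => // _; apply: (aut_actM to).
Qed.

Definition is_invariant n : {pred bar_chain G n} :=
  fun c => [forall q : Q, bar_act q c == c].

Fact is_invariant_zmod_closed n : zmod_closed (@is_invariant n).
Proof.
split=> [|c d]; first by apply/forallP => q; rewrite raddf0.
move=> /forallP ic /forallP id; apply/forallP => q.
by rewrite raddfB /= (eqP (ic q)) (eqP (id q)).
Qed.

HB.instance Definition _ n :=
  GRing.isZmodClosed.Build (bar_chain G n) (@is_invariant n)
    (@is_invariant_zmod_closed n).

Record inv_chain n := InvChain {
  inv_chain_val :> bar_chain G n;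
  inv_chainP : inv_chain_val \in @is_invariant n
}.

HB.instance Definition _ n := [isSub for @inv_chain_val n].
HB.instance Definition _ n := [Choice of inv_chain n by <:].
HB.instance Definition _ n := [SubChoice_isSubZmodule of inv_chain n by <:].

Fact inv_bd_subproof n (c : inv_chain n.+1) :
  bar_bd (val c) \in @is_invariant n.
Proof.
apply/forallP => q; rewrite bar_act_bd.
by have /forallP/(_ q)/eqP-> := inv_chainP c.
Qed.

Definition inv_bd n (c : inv_chain n.+1) : inv_chain n :=
  InvChain (inv_bd_subproof c).

Fact inv_bd_is_additive n : zmod_morphism (@inv_bd n).
Proof. by move=> c d; apply: val_inj; rewrite /= !raddfB. Qed.

HB.instance Definition _ n :=
  GRing.isZmodMorphism.Build (inv_chain n.+1) (inv_chain n) (@inv_bd n)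
    (@inv_bd_is_additive n).

Fact inv_bdK n (c : inv_chain n.+2) : inv_bd (inv_bd c) = 0.
Proof. by apply: val_inj; rewrite [RHS]raddf0 /= bar_bdK. Qed.

Definition inv_bar_complex : chain_complex := ChainComplex inv_bdK.

Definition inv_homology (i : nat) : zmodType := homology inv_bar_complex i.

End InvariantComplex.

(* The additive group of integers, in multiplicative notation. *)
Definition intG : groupType := Algebra.to_multiplicative int.

Definition neg_act (n : intG) (q : 'Z_2) : intG :=
  if q == 0 then n else - (n : int).

Fact neg_act_is_action : is_action [set: 'Z_2] neg_act.
Proof.
apply: is_total_action => [n|n p q]; rewrite /neg_act //.
by case: p q => [[|[|//]] ?] [[|[|//]] ?] //=; rewrite opprK.
Qed.

Fact neg_actM q : {morph (Action neg_act_is_action)^~ q : m n / (m * n)%g}.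
Proof. by move=> m n; rewrite /= /neg_act; case: ifP => // _; apply: opprD. Qed.

Definition neg_aut_action : aut_action 'Z_2 intG := AutAction neg_actM.

(* Main.v *)
Require Import Defs.
From HB Require Import structures.
From mathcomp Require Import all_boot all_order all_algebra all_fingroup.
From mathcomp Require Import generic_quotient ring_quotient freeg boolp.
From mathcomp Require Import zify ring.

Set Implicit Arguments.
Unset Strict Implicit.
Unset Printing Implicit Defensive.

Import GRing.Theory.

Local Open Scope ring_scope.

(** Put sigma = the sign involution, which acts on the bar chains C_n of the
    integers by negating all entries of a tuple. The only tuple that sigma
    fixes is (0, ..., 0). The chains on these tuples are the bar complex of the
    trivial group, which is exact in positive degrees, and they form a direct
    summand of the complex C. A complement is the subcomplex D of chains whose
    coefficients sum to 0: if deg c is the sum of the coefficients of c, then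
    c |-> c - deg c [0|...|0] is an equivariant retraction (red) of C onto D.
    So the homology of C^sigma and of D^sigma agree in positive degrees
    (is_boundary_red).

    Since sigma acts freely on the nonzero tuples, D is a complex of free
    modules over the group ring of Z/2: for s = 1 and s = -1, an element x
    with s sigma x = x has the form w + s sigma w (red_flip_exact). As the
    circle is a classifying space of the integers, the homology of D is
    concentrated in degree 1, where the winding number [a] |-> a identifies it
    with Z, on which sigma acts by -1. This is proved by an explicit
    contraction, bar_contract. Hence D is, up to a shift, a free resolution of
    the sign module, and the homology of D^sigma is the homology of Z/2 with
    coefficients in that module: Z/2 in odd degrees and 0 in even degrees.

    That last computation is done by dimension shifting. Write D^s for the
    subcomplex of those x with s sigma x = x. The short exact sequence
    0 -> D^(-s) -> D -> D^s -> 0 with second map w |-> w + s sigma w has a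
    connecting map H_(n+1)(D^s) -> H_n(D^(-s)). For n > 0 it is injective, and
    its image consists of the classes that bound in D (twisted_bd_norm,
    twisted_cycle_norm). The induction starts at degree 1 of D^+, where
    w + sigma w is a boundary exactly when the winding number of w is even
    (twisted_bd_norm1), and at degree 2 of D^+, which has no homology. *)

(** * Dimension shifting for a complex with an involution *)

Lemma addr_eq_subr (V : zmodType) (a b c d : V) :
  a + b = c + d -> b - d = c - a.
Proof.
by move=> e; apply/eqP; rewrite subr_eq addrAC -e addrAC subrr add0r.
Qed.

Section Twist.

Variables (V : zmodType) (sigma : {additive V -> V}).

(** The involution multiplied by the sign s, where s = true stands for -1. *)
Definition twist (s : bool) (x : V) : V := if s then - sigma x else sigma x.

Fact twist_is_additive s : zmod_morphism (twist s).
Proof. by case: s => x y; rewrite /twist raddfB // opprD. Qed.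

HB.instance Definition _ s :=
  GRing.isZmodMorphism.Build V V (twist s) (twist_is_additive s).

Lemma twistC s x : twist (~~ s) x = - twist s x.
Proof. by case: s; rewrite /twist ?opprK. Qed.

Hypothesis sigmaK : involutive sigma.

Lemma twistK s : involutive (twist s).
Proof. by case: s => x; rewrite /twist ?raddfN ?opprK sigmaK. Qed.

Lemma twist_norm s w : twist s (w + twist s w) = w + twist s w.
Proof. by rewrite raddfD /= twistK addrC. Qed.

End Twist.

Arguments twist : simpl never.

Section DimensionShift.

(* The hypotheses say that D is, in positive degrees, a resolution of the sign
   module by cohomologically trivial modules: twist_exact is the vanishing of
   the Tate cohomology of each D n, and eps identifies the homology in
   degree 1. *)
Variables (D : chain_complex) (sigma : forall n, {additive D n -> D n}).
Hypothesis sigmaK : forall n, involutive (@sigma n).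
Hypothesis sigma_bd : forall n (x : D n.+1),
  sigma n (boundary D n x) = boundary D n (sigma n.+1 x).
Hypothesis twist_exact : forall n s (x : D n),
  twist (sigma n) s x = x -> exists w, x = w + twist (sigma n) s w.
Hypothesis bd_exact : forall n (x : D n.+2),
  boundary D n.+1 x = 0 -> exists u, boundary D n.+2 u = x.
Hypothesis bd1 : forall x : D 1, boundary D 0 x = 0.
Variable eps : {additive D 1 -> int}.
Hypothesis eps_bd : forall u, eps (boundary D 1 u) = 0.
Hypothesis eps_sigma : forall x, eps (sigma 1 x) = - eps x.
Hypothesis eps_exact : forall x, eps x = 0 -> exists u, boundary D 1 u = x.
Variable e1 : D 1.
Hypothesis eps_e1 : eps e1 = 1.

Local Notation bd := (boundary D _).
Local Notation tw := (twist (sigma _)).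

Lemma twist_bd n s (x : D n.+1) : tw s (bd x) = bd (tw s x).
Proof. by case: s; rewrite /twist sigma_bd ?raddfN. Qed.

Definition twisted_cycle s n (x : D n.+1) := tw s x = x /\ bd x = 0.
Definition twisted_bd s n (x : D n.+1) :=
  exists2 u : D n.+2, tw s u = u & bd u = x.

(** The connecting map of 0 -> D^(-s) -> D -> D^s -> 0 sends the class of
    w + s sigma w to the class of the boundary of w. It is well defined by the
    exactness of the kernel of 1 + s sigma, and injective because D has no
    homology in the degree of w. *)
Lemma twisted_bd_norm s n (w : D n.+2) :
  twisted_bd s (w + tw s w) <-> twisted_bd (~~ s) (bd w).
Proof.
split=> [[u /twist_exact[v ->]] | [v sv dv]].
  rewrite raddfD /= -twist_bd => e; exists (w - bd v); last first.
    by rewrite raddfB /= boundaryK subr0.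
  by rewrite twistC raddfB /= opprB; apply: addr_eq_subr.
have [|u du] := @bd_exact n (w - v); first by rewrite raddfB /= dv subrr.
exists (u + tw s u); first exact: twist_norm.
move: sv; rewrite twistC => sv.
rewrite raddfD /= -twist_bd du raddfB /= addrACA -[RHS]addr0; congr (_ + _).
by rewrite -opprD -{1}sv addNr oppr0.
Qed.

Lemma twisted_cycle_norm s n (w : D n.+2) :
  twisted_cycle s (w + tw s w) <-> twisted_cycle (~~ s) (bd w).
Proof.
rewrite /twisted_cycle twist_norm // boundaryK raddfD /= -twist_bd twistC.
split=> [[_ e]|[e _]]; split=> //.
  by apply/eqP; rewrite eqr_oppLR -addr_eq0 addrC e.
by rewrite -{1}e addNr.
Qed.

Definition twisted_acyclic s n :=
  forall x : D n.+1, twisted_cycle s x -> twisted_bd s x.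

(** The element g represents the nonzero class of a homology group with two
    elements. *)
Definition twisted_generator s n (g : D n.+1) :=
  [/\ twisted_cycle s g, ~ twisted_bd s g &
      forall x, twisted_cycle s x -> twisted_bd s x \/ twisted_bd s (x - g)].

Lemma twisted_acyclicS s n :
  twisted_acyclic s n -> twisted_acyclic (~~ s) n.+1.
Proof.
move=> acy x cx; case: (cx) => /twist_exact[w ew] _; rewrite ew in cx *.
apply/twisted_bd_norm; rewrite negbK; apply: acy.
by move/twisted_cycle_norm: cx; rewrite negbK.
Qed.

Lemma twisted_generatorS s n (w : D n.+2) :
  twisted_generator s (bd w) -> twisted_generator (~~ s) (w + tw (~~ s) w).
Proof.
move=> [cg nbg gen]; split.
- by apply/twisted_cycle_norm; rewrite negbK.
- by move/twisted_bd_norm; rewrite negbK.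
move=> x cx; case: (cx) => /twist_exact[v ev] _; rewrite ev in cx *.
move/twisted_cycle_norm: cx; rewrite negbK => /gen[bv|bv].
  by left; apply/twisted_bd_norm; rewrite negbK.
right; rewrite opprD addrACA -raddfB; apply/twisted_bd_norm.
by rewrite negbK raddfB.
Qed.

(** In degree 1, an invariant element has winding number 0, because the
    involution changes the sign of the winding number. *)
Lemma invariant_cycle_bounds n (x : D n.+1) :
  twisted_cycle false x -> exists w, bd w = x.
Proof.
case: n x => [|n] x [sx dx]; last exact: bd_exact.
apply: eps_exact; have /eqP := eps_sigma x.
rewrite [sigma 1 x]sx -addr_eq0 -mulr2n Num.Theory.mulrn_eq0.
by move/eqP.
Qed.

(** The map w + sigma w |-> eps w is well defined modulo 2, since w is
    determined up to elements v - sigma v, on which eps takes the even values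
    2 eps v. Conversely, an even winding number can be removed by subtracting
    such an element, and what remains is a boundary. *)
Lemma twisted_bd_norm1 (w : D 1) :
  twisted_bd false (w + tw false w) <-> exists k, eps w = k + k.
Proof.
split=> [[u /twist_exact[v ->]] | [k ek]].
  rewrite raddfD /= -twist_bd => e.
  have /twist_exact[x ex] : tw true (w - bd v) = w - bd v.
    by rewrite (twistC _ false) raddfB /= opprB; apply: addr_eq_subr.
  exists (eps x); rewrite -{1}[w](subrK (bd v)) ex raddfD eps_bd addr0.
  by rewrite raddfD raddfN eps_sigma opprK.
have [y ey ty] : exists2 y : D 1, eps y = k + k & tw false y = - y.
  exists (e1 *~ k + tw true (e1 *~ k)); last first.
    by rewrite -[in RHS]twist_norm // -twistC.
  by rewrite raddfD /= raddfN eps_sigma opprK raddfMz eps_e1 intz.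
have [|u du] := @eps_exact (w - y); first by rewrite raddfB ek ey subrr.
exists (u + tw false u); first exact: twist_norm.
by rewrite raddfD -twist_bd du raddfB /= ty opprK addrACA addNr addr0.
Qed.

Lemma twisted_generator1 : @twisted_generator false 0 (e1 + tw false e1).
Proof.
split; first by split; [exact: twist_norm | exact: bd1].
  by move/twisted_bd_norm1=> [k]; rewrite eps_e1; lia.
move=> x [/twist_exact[w ->] _].
have [k [ek|ek]] : exists k, eps w = k + k \/ eps w = k + k + 1.
- by exists (divz (eps w) 2); lia.
- by left; apply/twisted_bd_norm1; exists k.
right; rewrite opprD addrACA -raddfB; apply/twisted_bd_norm1; exists k.
by rewrite raddfB /= eps_e1 ek addrK.
Qed.

(** The connecting map to H_1(D^-) is injective, and its image consists of
    classes v - sigma v that bound in D, hence have winding number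
    2 eps v = 0. But then v is a boundary, and so the class is zero. *)
Lemma twisted_acyclic2 : twisted_acyclic false 1.
Proof.
move=> x cx; case: (cx) => /twist_exact[w ew] _; rewrite ew in cx *.
apply/twisted_bd_norm; move/twisted_cycle_norm: cx => [/twist_exact[v ev] _].
have [|u du] := @eps_exact v.
  have := eps_bd w; rewrite ev raddfD /= raddfN eps_sigma opprK => /eqP.
  by rewrite -mulr2n Num.Theory.mulrn_eq0 => /eqP.
exists (u + tw true u); first exact: twist_norm.
by rewrite raddfD /= -twist_bd du -ev.
Qed.

Lemma invariant_homology_odd m :
  exists g : D m.*2.+1, twisted_generator false g.
Proof.
elim: m => [|m [g gen]].
  by exists (e1 + tw false e1); apply: twisted_generator1.
have [w dw] : exists w, bd w = g by case: gen => /invariant_cycle_bounds.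
rewrite -dw in gen; have := twisted_generatorS gen.
set h := (w + _) => gen'.
have [v dv] : exists v, bd v = h by case: gen' => -[_ /bd_exact].
rewrite -dv in gen'; exists (v + tw false v).
exact: (twisted_generatorS gen').
Qed.

Lemma invariant_homology_even m : twisted_acyclic false m.*2.+1.
Proof.
elim: m => [|m IHm]; first exact: twisted_acyclic2.
by do 2 move/twisted_acyclicS: IHm => IHm.
Qed.

End DimensionShift.

(** * The bar complex by recursion on the first entries *)

(** Identities of abelian groups between chains are checked on coefficients,
    which live in a ring. *)
Ltac chain_ring :=
  apply/eqP/freeg_eqP => ?; rewrite !(coeffD, coeffN, coeff0); ring.

Section BarGeneral.

Variable G : groupType.

Lemma bar_gen_ind n (P : bar_chain G n -> Prop) :
  P 0 -> (forall c d, P c -> P d -> P (c - d)) -> (forall t, P << t >>) ->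
  forall c, P c.
Proof.
move=> P0 PB Pg.
have PN c : P c -> P (- c) by move=> Pc; rewrite -sub0r; apply: PB.
have PD c d : P c -> P d -> P (c + d).
  by move=> Pc Pd; rewrite -[d]opprK; apply: PB => //; apply: PN.
elim/bar_ind => // m t.
have PM k : P << k%:Z *g t >>.
  elim: k => [|k IHk]; first by rewrite freegU0.
  by rewrite intS addrC -freegUD; apply: PD.
by case: m => k //; rewrite NegzE -freegUN; apply: PN.
Qed.

Definition bar_cons (x : G) n : bar_chain G n -> bar_chain G n.+1 :=
  fglift (fun t : n.-tuple G => << [tuple of x :: t] >> : bar_chain G n.+1).

HB.instance Definition _ x n :=
  GRing.isZmodMorphism.Build (bar_chain G n) (bar_chain G n.+1) (@bar_cons x n)
    (lift_is_additive _).

Lemma bar_consU x n (t : n.-tuple G) :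
  bar_cons x << t >> = << [tuple of x :: t] >>.
Proof. by rewrite /bar_cons liftU scale1r. Qed.

Lemma bar_cons_ind n (P : bar_chain G n.+1 -> Prop) :
  P 0 -> (forall c d, P c -> P d -> P (c - d)) ->
  (forall x c, P (bar_cons x c)) -> forall c, P c.
Proof.
move=> P0 PB PC; apply: bar_gen_ind => // t.
by case/tupleP: t => x t; rewrite -bar_consU.
Qed.

Lemma bar_face0 n x (t : n.-tuple G) : bar_face 0 [tuple of x :: t] = t.
Proof.
by apply: eq_from_tnth => j; rewrite tnth_mktuple /= (tnth_nth 1%g).
Qed.

Lemma bar_face1 n x y (t : n.-tuple G) :
  bar_face 1 [tuple of x :: [tuple of y :: t]] = [tuple of (x * y)%g :: t].
Proof.
by apply: eq_from_tnth => -[[|j] jn]; rewrite tnth_mktuple (tnth_nth 1%g).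
Qed.

Lemma bar_faceSS n k x (t : n.+1.-tuple G) :
  bar_face k.+2 [tuple of x :: t] = [tuple of x :: bar_face k.+1 t].
Proof.
apply: eq_from_tnth => -[[|j] jn]; rewrite tnth_mktuple (tnth_nth 1%g) //.
rewrite [RHS](_ : _ = nth 1%g (bar_face k.+1 t) (Ordinal (jn : j < n)%N)) //.
by rewrite -tnth_nth tnth_mktuple /seq_face /= !ltnS !eqSS.
Qed.

Lemma bar_bdU1 n (t : n.+1.-tuple G) :
  bar_bd << t >> = \sum_(k < n.+2) << (-1) ^+ k *g bar_face k t >>.
Proof. by rewrite bar_bdU scale1r bar_bd_genE. Qed.

(** Faces 0 and 1 of [x|y|c] are explicit, and face k + 2 is x followed by
    face k + 1 of [y|c]. The last term corrects for face 0 of [y|c], which is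
    part of the boundary of [y|c] but does not occur here. *)
Lemma bar_bd_cons2 n x y (c : bar_chain G n) :
  bar_bd (bar_cons x (bar_cons y c)) =
  bar_cons y c - bar_cons (x * y)%g c - bar_cons x (bar_bd (bar_cons y c))
  + bar_cons x c.
Proof.
elim/bar_gen_ind: c => [|c d IHc IHd|t].
- by rewrite !raddf0 !addr0.
- by rewrite !raddfB /= IHc IHd; chain_ring.
rewrite !bar_consU !bar_bdU1 2!big_ord_recl [in RHS]big_ord_recl /=.
rewrite bar_face1 !bar_face0 expr0 expr1 raddfD /= bar_consU.
rewrite raddf_sum /= -!addrA; congr (_ + _).
rewrite -freegUN; congr (_ + _).
rewrite opprD addrAC addNr add0r -sumrN; apply: eq_bigr => k _.
rewrite /bump /= !add1n bar_faceSS /bar_cons liftU.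
apply/eqP/freeg_eqP => u.
by rewrite coeffN coeffZ !coeffU !exprS !mulN1r !mulNr mul1r opprK.
Qed.

Lemma bar_bd_cons1 x (c : bar_chain G 0) : bar_bd (bar_cons x c) = 0.
Proof.
elim/bar_gen_ind: c => [|c d IHc IHd|t].
- by rewrite !raddf0.
- by rewrite !raddfB /= IHc IHd subrr.
rewrite bar_consU bar_bdU1 !big_ord_recl big_ord0 /= [bar_face 1 _]tuple0.
by rewrite [bar_face 0 _]tuple0 addr0 freegUD freegU0.
Qed.

Definition unit_tuple n : n.-tuple G := [tuple of nseq n 1%g].

Lemma bar_face_unit n k : bar_face k (unit_tuple n.+1) = unit_tuple n.
Proof.
apply: eq_from_tnth => j; rewrite tnth_mktuple /seq_face !nth_nseq.
by rewrite (tnth_nth 1%g) nth_nseq !if_same mulg1; case: ifP; rewrite ?if_same.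
Qed.

Lemma alternating_sum n : \sum_(k < n) (-1) ^+ k = (odd n)%:Z.
Proof.
elim: n => [|n IHn]; first by rewrite big_ord0.
by rewrite big_ord_recr /= IHn -signr_odd; case: odd.
Qed.

Lemma bar_bd_unit n m :
  bar_bd << m *g unit_tuple n.+1 >> = << (odd n)%:Z * m *g unit_tuple n >>.
Proof.
rewrite bar_bdU bar_bd_genE; under eq_bigr do rewrite bar_face_unit.
have -> : (odd n : int) = odd n.+2 by rewrite /= negbK.
rewrite -alternating_sum; apply/eqP/freeg_eqP => t.
rewrite coeffZ raddf_sum /= coeffU; under eq_bigr do rewrite coeffU.
by rewrite -mulr_suml mulrCA mulrA.
Qed.

Lemma deg_bar_bd n (c : bar_chain G n.+1) : deg (bar_bd c) = (odd n)%:Z * deg c.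
Proof.
elim/bar_gen_ind: c => [|c d IHc IHd|t].
- by rewrite !raddf0 mulr0.
- by rewrite !raddfB /= IHc IHd mulrBr.
rewrite bar_bdU1 raddf_sum /= degU mulr1.
under eq_bigr do rewrite degU.
by rewrite alternating_sum /= negbK.
Qed.

End BarGeneral.

(** * A contraction of the bar complex of the integers *)

Section IntSum.

Variable V : zmodType.
Implicit Types (F G : int -> V) (a b : int).

(** Identities of oriented sums are derived from their difference operators,
    which needs no distinction of signs. *)
Lemma int_step_eq F G :
  F 0 = G 0 -> (forall a, F (a + 1) - F a = G (a + 1) - G a) -> F =1 G.
Proof.
move=> FG0 FGS; elim/int_rec => // n FGn.
  by have := FGS n%:Z; rewrite FGn -PoszD addn1; apply: addIr.
have := FGS (- n.+1%:Z); rewrite intS opprD addrAC addNr add0r FGn.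
by move/addrI/oppr_inj.
Qed.

(** The oriented sum of F over the interval from 0 to a, so that its
    difference operator is F also for negative a. *)
Definition isum F a : V :=
  match a with
  | Posz n => \sum_(k < n) F k%:Z
  | Negz n => - \sum_(k < n.+1) F (Negz k)
  end.

Lemma isum0 F : isum F 0 = 0.
Proof. exact: big_ord0. Qed.

Lemma isumS F a : isum F (a + 1) = isum F a + F a.
Proof.
case: a => [n|[|n]].
- by rewrite -PoszD addn1 /isum big_ord_recr.
- by rewrite /isum /= big_ord1 big_ord0 addNr.
have -> : Negz n.+1 + 1 = Negz n by lia.
by rewrite /isum [in RHS]big_ord_recr opprD subrK.
Qed.

Lemma isumD F G a : isum (fun k => F k + G k) a = isum F a + isum G a.
Proof. by case: a => n; rewrite /isum big_split // opprD. Qed.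

Lemma isumB F G a : isum (fun k => F k - G k) a = isum F a - isum G a.
Proof.
by case: a => n; rewrite /isum sumrB // opprB opprK addrC.
Qed.

Lemma isum_cst v a : isum (fun=> v) a = v *~ a.
Proof.
move: a; apply: int_step_eq => [|a]; first by rewrite isum0.
by rewrite isumS addrC addKr mulrzDr addrC addKr.
Qed.

Lemma isum_telescope F a : isum (fun k => F (k + 1) - F k) a = F a - F 0.
Proof.
move: a; apply: int_step_eq => [|a]; first by rewrite isum0 subrr.
by rewrite isumS addrC addKr opprB addrA subrK.
Qed.

Lemma isum_shift F a b :
  isum (fun k => F (k + b)) a = isum F (a + b) - isum F b.
Proof.
move: a; apply: int_step_eq => [|a]; first by rewrite isum0 add0r subrr.
rewrite isumS [LHS]addrC addKr (addrAC a) isumS opprB addrA subrK.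
by rewrite [RHS]addrC addKr.
Qed.

End IntSum.

Lemma isum_raddf (U V : zmodType) (f : {additive U -> V}) (F : int -> U) a :
  f (isum F a) = isum (f \o F) a.
Proof. by case: a => n; rewrite /isum ?raddfN raddf_sum. Qed.

Lemma eq_isum (V : zmodType) (F G : int -> V) a : F =1 G -> isum F a = isum G a.
Proof. by move=> FG; congr isum; apply/funext. Qed.

Section IntContraction.

Local Notation C := (bar_chain intG).
Local Notation cons a c := (@bar_cons intG (a : int) _ c).

(** The terms [1|k|...] sum over 0 <= k < a, which expresses [a] as a copies
    of [1] up to the boundary of the chain of the [1|k]. The term [0|0|...]
    cancels the degenerate chains that this telescoping leaves over in the
    unnormalized complex. *)
Definition bar_contract n : C n.+1 -> C n.+2 :=
  fglift (fun t : n.+1.-tuple intG =>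
    isum (fun k => cons 1 (cons k << [tuple of behead t] >>)) (thead t)
    - cons 0 (cons 0 << [tuple of behead t] >>) : C n.+2).

HB.instance Definition _ n :=
  GRing.isZmodMorphism.Build (C n.+1) (C n.+2) (@bar_contract n)
    (lift_is_additive _).

Lemma bar_contract_cons n (a : int) (c : C n) :
  bar_contract (cons a c) =
  isum (fun k => cons 1 (cons k c)) a - cons 0 (cons 0 c).
Proof.
elim/bar_gen_ind: c => [|c d IHc IHd|t].
- rewrite !raddf0 addr0 (eq_isum (G := fun=> 0)) ?isum_cst ?mul0rz // => k.
  by rewrite !raddf0.
- rewrite !raddfB /= IHc IHd.
  rewrite [in RHS](eq_isum
    (G := fun k => cons 1 (cons k c) - cons 1 (cons k d))).
    by rewrite isumB; chain_ring.
  by move=> k; rewrite !raddfB.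
rewrite bar_consU /bar_contract liftU scale1r theadE.
by have -> : [tuple of behead [tuple of (a : intG) :: t]] = t by apply: val_inj.
Qed.

Lemma int_bd_cons2 n (a b : int) (c : C n) :
  bar_bd (cons a (cons b c)) =
  cons b c - cons (a + b) c - cons a (bar_bd (cons b c)) + cons a c.
Proof. exact: bar_bd_cons2. Qed.

(** With [a|b|c] a chain, the terms [k|b|c] - [k+1|b|c] of the boundary of the
    contraction telescope to [0|b|c] - [a|b|c]. The terms [1|k+b|c] sum over the
    interval from b to a + b, so that they cancel the contraction of the faces
    [b|c] and [a+b|c]. The summand [0|0|...] accounts for the remaining
    [0|b|c]. *)
Lemma bar_contractP n (c : C n.+2) :
  bar_bd (bar_contract c) + bar_contract (bar_bd c) = - c.
Proof.
elim/bar_cons_ind: c => [|c d IHc IHd|a c].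
- by rewrite !raddf0 addr0.
- by rewrite !raddfB /= -IHc -IHd; chain_ring.
elim/bar_cons_ind: c => [|c d IHc IHd|b c].
- by rewrite !raddf0 addr0.
- by rewrite !raddfB /= -IHc -IHd; chain_ring.
rewrite int_bd_cons2 !(raddfD, raddfN) /= !bar_contract_cons.
rewrite !(raddfD, raddfN) /= isum_raddf.
set e := bar_bd (cons b c).
pose F k := cons 1 (cons k c) : C n.+2.
rewrite (eq_isum (G := fun k => (F (k + b) - F k) - (cons (k + 1) (cons b c)
   - cons k (cons b c)) + cons 1 (cons k e) )); last first.
  move=> k; rewrite /= !int_bd_cons2 !(raddfD, raddfN) /= -/e /F.
  by rewrite [k + 1]addrC; chain_ring.
rewrite isumD isumB (isum_telescope (fun k => cons k (cons b c)) a) isumB.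
rewrite isum_shift.
have -> : bar_bd (cons 0 (cons 0 (cons b c))) =
    cons 0 (cons 0 e) - cons 0 (cons 0 c) + cons 0 (cons b c).
  rewrite !int_bd_cons2 !(raddfD, raddfN) /= !add0r -/e; chain_ring.
rewrite -/F; chain_ring.
Qed.

Lemma bar_contract1 (a : int) (c : C 0) :
  bar_bd (bar_contract (cons a c)) = cons 1 c *~ a - cons a c.
Proof.
rewrite bar_contract_cons raddfB /= isum_raddf.
rewrite !int_bd_cons2 bar_bd_cons1 raddf0.
rewrite add0r subr0 subrr add0r.
rewrite (eq_isum (G := fun k : int => cons 1 c - (cons (k + 1) c - cons k c))).
  by rewrite isumB isum_cst (isum_telescope (fun k => cons k c) a); chain_ring.
move=> k; rewrite /= !int_bd_cons2 bar_bd_cons1 raddf0 [k + 1]addrC.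
chain_ring.
Qed.

End IntContraction.

(** * Quotients of order at most two *)

Section QuotientGroups.

Variables (U : zmodType) (P : zmodClosed U).
Local Notation Q := {ideal_quot P}.
Local Notation proj := (\pi_Q%qT : U -> Q).

Lemma quot_eqE (u v : U) : (proj u == proj v) = (u - v \in P).
Proof. by rewrite -Quotient.idealrBE. Qed.

Lemma quotient_trivial : (forall u, u \in P) -> zmod_isog Q 'I_1.
Proof.
move=> allP; exists (\0 : {additive Q -> 'I_1}); exists (fun=> 0) => [x|y].
  by rewrite -(reprK x) -(raddf0 proj); apply/eqP; rewrite quot_eqE allP.
by rewrite [RHS]ord1.
Qed.

Lemma quotient_order2 (g : U) :
  g \notin P -> (forall u, u \in P \/ u - g \in P) -> zmod_isog Q 'Z_2.
Proof.
move=> gP cover; pose f (x : Q) : 'Z_2 := if repr x \in P then 0%R else 1%R.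
have f_proj u : f (proj u) = if u \in P then 0%R else 1%R.
  have : repr (proj u) - u \in P by rewrite -quot_eqE reprK.
  by rewrite /f rpredBC => /(rpredBr u) <-; rewrite subKr.
have fB : zmod_morphism f.
  move=> x y; rewrite -(reprK x) -(reprK y) -(raddfB proj) !f_proj.
  move: (repr x) (repr y) => u v.
  have [uP|uP] := boolP (u \in P); have [vP|vP] := boolP (v \in P).
  - by rewrite rpredB // subrr.
  - by rewrite rpredBl // (negPf vP); apply: val_inj.
  - by rewrite rpredBr // (negPf uP) subr0.
  have -> : u - v = (u - g) - (v - g) by rewrite opprB addrA subrK.
  case: (cover u) (cover v) => [/(negP uP)//|ug] [/(negP vP)//|vg].
  by rewrite rpredB // subrr.
pose F : {additive Q -> 'Z_2} :=
  HB.pack f (GRing.isZmodMorphism.Build Q 'Z_2 f fB).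
exists F; exists (fun b => if b == 0 then 0 else proj g) => [x|b].
  rewrite -(reprK x) [F _]f_proj; move: (repr x) => u.
  have [uP|uP] /= := boolP (u \in P).
    by rewrite -(raddf0 proj); apply/eqP; rewrite quot_eqE sub0r rpredN.
  have : u - g \in P by case: (cover u) => // /(negP uP).
  by rewrite rpredBC -quot_eqE => /eqP.
case: eqVneq => [->|b0]; first exact: raddf0.
rewrite [F _]f_proj (negPf gP).
by case: b b0 => [[|[|//]] ib] //= _; apply: val_inj.
Qed.

End QuotientGroups.

(** * Reduced chains *)

Section Reduced.

Variable G : groupType.

(** A nontrivial group acting by automorphisms fixes the tuple of units, so that
    the bar chains are not a free module over its group ring. The chains with
    coefficient sum 0 are isomorphic to the chains on the other tuples. *)
Definition is_reduced n : {pred bar_chain G n} := fun c => deg c == 0.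

Fact is_reduced_zmod_closed n : zmod_closed (@is_reduced n).
Proof.
split=> [|c d]; rewrite !unfold_in ?deg0 // raddfB /=.
by move=> /eqP-> /eqP->; rewrite subrr.
Qed.

HB.instance Definition _ n :=
  GRing.isZmodClosed.Build (bar_chain G n) (@is_reduced n)
    (@is_reduced_zmod_closed n).

Record red_chain n := RedChain {
  red_chain_val :> bar_chain G n;
  red_chainP : red_chain_val \in @is_reduced n
}.

HB.instance Definition _ n := [isSub for @red_chain_val n].
HB.instance Definition _ n := [Choice of red_chain n by <:].
HB.instance Definition _ n := [SubChoice_isSubZmodule of red_chain n by <:].

Lemma deg_red_chain n (x : red_chain n) : deg (val x) = 0.
Proof. exact/eqP/red_chainP. Qed.

Fact red_subproof n (c : bar_chain G n) :
  c - << deg c *g unit_tuple G n >> \in @is_reduced n.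
Proof. by rewrite unfold_in raddfB /= degU subrr. Qed.

Definition red n (c : bar_chain G n) : red_chain n := RedChain (red_subproof c).

Fact red_is_additive n : zmod_morphism (@red n).
Proof.
move=> c d; apply: val_inj; rewrite raddfB /= raddfB /= -freegUB.
by rewrite !opprD opprK addrACA.
Qed.

HB.instance Definition _ n :=
  GRing.isZmodMorphism.Build (bar_chain G n) (red_chain n) (@red n)
    (@red_is_additive n).

Lemma redE n (c : bar_chain G n) :
  val (red c) = c - << deg c *g unit_tuple G n >>.
Proof. by []. Qed.

Lemma red_id n (x : red_chain n) : red (val x) = x.
Proof. by apply: val_inj; rewrite redE deg_red_chain freegU0 subr0. Qed.

Lemma red_unit n m : red << m *g unit_tuple G n >> = 0.
Proof. by apply: val_inj; rewrite redE degU subrr. Qed.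

Fact red_bd_subproof n (x : red_chain n.+1) : bar_bd (val x) \in @is_reduced n.
Proof. by rewrite unfold_in deg_bar_bd deg_red_chain mulr0. Qed.

Definition red_bd n (x : red_chain n.+1) : red_chain n :=
  RedChain (red_bd_subproof x).

Fact red_bd_is_additive n : zmod_morphism (@red_bd n).
Proof. by move=> c d; apply: val_inj; rewrite /= !raddfB. Qed.

HB.instance Definition _ n :=
  GRing.isZmodMorphism.Build (red_chain n.+1) (red_chain n) (@red_bd n)
    (@red_bd_is_additive n).

Fact red_bdK n (x : red_chain n.+2) : red_bd (red_bd x) = 0.
Proof. by apply: val_inj; rewrite [RHS]raddf0 /= bar_bdK. Qed.

Definition red_complex : chain_complex := ChainComplex red_bdK.

Lemma red_bdE n (c : bar_chain G n.+1) : red_bd (red c) = red (bar_bd c).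
Proof.
by apply: val_inj; rewrite [LHS]/= raddfB /= bar_bd_unit deg_bar_bd.
Qed.

Lemma red_complex_bd0 (x : red_chain 1) : red_bd x = 0.
Proof.
apply: val_inj => /=; elim/bar_cons_ind: (val x) => [|c d IHc IHd|a c].
- by rewrite raddf0.
- by rewrite raddfB /= IHc IHd subrr.
- exact: bar_bd_cons1.
Qed.

End Reduced.

Section ReducedAction.

Variables (Q : finGroupType) (G : groupType) (to : Defs.aut_action Q G).

Lemma aut_act1 q : to 1%g q = 1%g.
Proof. by apply: (@mulgI _ (to 1%g q)); rewrite -aut_actM !mulg1. Qed.

Lemma bar_act_unit n q m :
  bar_act to q << m *g unit_tuple G n >> = << m *g unit_tuple G n >>.
Proof.
rewrite bar_actU; congr (Freeg [:: (_, _)]).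
by apply: val_inj; rewrite /= map_nseq aut_act1.
Qed.

Lemma deg_bar_act n q (c : bar_chain G n) : deg (bar_act to q c) = deg c.
Proof.
elim/bar_gen_ind: c => [|c d IHc IHd|t]; first by rewrite !raddf0.
  by rewrite !raddfB /= IHc IHd.
by rewrite bar_actU !degU.
Qed.

Fact red_act_subproof n q (x : red_chain G n) :
  bar_act to q (val x) \in @is_reduced G n.
Proof. by rewrite unfold_in deg_bar_act deg_red_chain. Qed.

Definition red_act n q (x : red_chain G n) : red_chain G n :=
  RedChain (red_act_subproof q x).

Fact red_act_is_additive n q : zmod_morphism (@red_act n q).
Proof. by move=> c d; apply: val_inj; rewrite /= !raddfB. Qed.

HB.instance Definition _ n q :=
  GRing.isZmodMorphism.Build (red_chain G n) (red_chain G n) (@red_act n q)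
    (@red_act_is_additive n q).

Lemma red_actE n q (c : bar_chain G n) :
  red_act q (red c) = red (bar_act to q c).
Proof.
by apply: val_inj; rewrite [LHS]/= raddfB /= bar_act_unit deg_bar_act.
Qed.

Lemma red_act_bd n q (x : red_chain G n.+1) :
  red_act q (red_bd x) = red_bd (red_act q x).
Proof. by apply: val_inj; rewrite /= bar_act_bd. Qed.

End ReducedAction.

(** * The sign involution on the integers *)

Section Flip.

Local Notation C := (bar_chain intG).
Local Notation D := (red_chain intG).
Local Notation cons a c := (@bar_cons intG (a : int) _ c).

Definition flip n : C n -> C n := bar_act neg_aut_action (1%R : 'Z_2).
HB.instance Definition _ n := GRing.Additive.on (@flip n).

Definition red_flip n : {additive D n -> D n} :=
  red_act neg_aut_action (1%R : 'Z_2).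

Lemma flipU n m (t : n.-tuple intG) :
  flip << m *g t >> = << m *g [tuple of map (fun x : int => - x : intG) t] >>.
Proof. by rewrite /flip bar_actU; congr (Freeg [:: (_, _)]). Qed.

Lemma flipK n : involutive (@flip n).
Proof.
elim/bar_gen_ind => [|c d IHc IHd|t]; first by rewrite !raddf0.
  by rewrite !raddfB /= IHc IHd.
rewrite !flipU; congr (Freeg [:: (_, _)]); apply: val_inj.
by rewrite /= -map_comp map_id_in // => x _; apply: opprK.
Qed.

Lemma red_flipK n : involutive (red_flip n).
Proof. by move=> x; apply: val_inj; apply: flipK. Qed.

Lemma invariantE n (c : C n) :
  (c \in @is_invariant _ _ neg_aut_action n) = (flip c == c).
Proof.
apply/forallP/eqP => [/(_ 1%R)/eqP // | fc [[|[|//]] iq]].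
  apply/eqP; elim/bar_gen_ind: c {fc} => [|c d IHc IHd|t].
  - by rewrite !raddf0.
  - by rewrite !raddfB /= IHc IHd.
  by rewrite bar_actU; congr (Freeg [:: (_, _)]); apply: val_inj; apply: map_id.
apply/eqP; rewrite -[RHS]fc; congr (bar_act _ _ _); exact: val_inj.
Qed.

(** The sign of the first nonzero entry, which selects one tuple from each free
    orbit of the sign involution. *)
Fixpoint lead_pos (s : seq int) : bool :=
  if s is x :: s' then if x == 0 then lead_pos s' else 0 < x else false.

Lemma lead_pos_opp (s : seq int) :
  has (fun x => x != 0) s -> lead_pos (map -%R s) = ~~ lead_pos s.
Proof.
elim: s => //= x s IHs; rewrite oppr_eq0; case: eqVneq => //= x0 _; lia.
Qed.

Definition pos_part n : C n -> C n :=
  fglift (fun t : n.-tuple intG => if lead_pos t then << t >> else 0 : C n).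
HB.instance Definition _ n :=
  GRing.isZmodMorphism.Build (C n) (C n) (@pos_part n) (lift_is_additive _).

Lemma pos_partU n (t : n.-tuple intG) :
  pos_part << t >> = if lead_pos t then << t >> else 0.
Proof. by rewrite /pos_part liftU scale1r. Qed.

(** Both sides vanish on the fixed tuple, and any other tuple occurs in exactly
    one of the two terms on the right. *)
Lemma red_split n (c : C n) :
  red c = red (pos_part c) + red (flip (pos_part (flip c))).
Proof.
elim/bar_gen_ind: c => [|c d IHc IHd|t].
- by rewrite !raddf0 addr0.
- by rewrite !raddfB /= IHc IHd addrACA opprD.
have [nz|/hasPn z] := boolP (has (fun x : int => x != 0) t).
  rewrite flipU !pos_partU lead_pos_opp //; case: lead_pos => /=.
    by rewrite !raddf0 addr0.
  by rewrite -flipU flipK raddf0 add0r.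
have -> : t = unit_tuple intG n.
  apply: eq_from_tnth => j; rewrite (tnth_nth 0) [RHS](tnth_nth 0) /= nth_nseq.
  by rewrite ltn_ord; apply/eqP/negbNE/z/mem_nth; rewrite size_tuple.
have fu : flip << unit_tuple intG n >> = << unit_tuple intG n >>.
  exact: bar_act_unit.
have pu : pos_part << unit_tuple intG n >> = 0.
  have np : lead_pos (unit_tuple intG n) = false by elim: n {fu t z}.
  by rewrite pos_partU np.
by rewrite fu pu !raddf0 red_unit addr0.
Qed.

Lemma red_flipE n (c : C n) : red_flip n (red c) = red (flip c).
Proof. exact: red_actE. Qed.

(** The part of x on one tuple from each free orbit is an element w as desired,
    up to multiples of the fixed tuple. These would obstruct the claim, since a
    fixed tuple is not of the form w + sigma w, but red removes them. *)
Lemma red_flip_exact n s (x : D n) : twist (red_flip n) s x = x ->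
  exists w, x = w + twist (red_flip n) s w.
Proof.
move=> sx; exists (red (pos_part (val x))).
rewrite -[LHS]red_id red_split; congr (_ + _).
have -> : red (flip (pos_part (flip (val x)))) =
  red_flip n (red (pos_part (val (red_flip n x)))) by rewrite red_flipE.
have -> : red_flip n x = if s then - x else x.
  by rewrite -[in RHS]sx /twist; case: s {sx}; rewrite ?opprK.
by rewrite /twist; case: s {sx} => //; rewrite !raddfN.
Qed.

(** On cycles, this induces the isomorphism of the first homology group of the
    integers with the integers. *)
Definition winding : C 1 -> int :=
  fglift (fun t : 1.-tuple intG => (thead t : int) : int^o).
Fact winding_is_additive : zmod_morphism winding.
Proof.
exact: (lift_is_additive (fun t : 1.-tuple intG => (thead t : int) : int^o)).
Qed.
HB.instance Definition _ :=
  GRing.isZmodMorphism.Build (C 1) int winding winding_is_additive.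

Lemma winding_cons a (c : C 0) : winding (cons a c) = a * deg c.
Proof.
elim/bar_gen_ind: c => [|c d IHc IHd|t]; first by rewrite !raddf0 mulr0.
  by rewrite !raddfB /= IHc IHd mulrBr.
by rewrite bar_consU /winding liftU degU scale1r mulr1.
Qed.

Lemma winding_bd (c : C 2) : winding (bar_bd c) = 0.
Proof.
elim/bar_cons_ind: c => [|c d IHc IHd|a c]; first by rewrite !raddf0.
  by rewrite !raddfB /= IHc IHd subrr.
elim/bar_cons_ind: c => [|c d IHc IHd|b c]; first by rewrite !raddf0.
  by rewrite !raddfB /= IHc IHd subrr.
rewrite int_bd_cons2 bar_bd_cons1 !(raddfD, raddfN) /= !raddf0 !winding_cons.
ring.
Qed.

Lemma winding_flip c : winding (flip c) = - winding c.
Proof.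
elim/bar_gen_ind: c => [|c d IHc IHd|t]; first by rewrite !raddf0.
  by rewrite !raddfB /= IHc IHd.
by case/tupleP: t => a t; rewrite flipU /winding !liftU !scale1r.
Qed.

Definition loop : 1.-tuple intG := [tuple of [:: (1%R : int) : intG]].

Lemma winding_contract (c : C 1) :
  bar_bd (bar_contract c) = << winding c *g loop >> - c.
Proof.
elim/bar_cons_ind: c => [|c d IHc IHd|a c].
- by rewrite !raddf0 freegU0 addr0.
- by rewrite !raddfB /= IHc IHd -freegUB; chain_ring.
rewrite bar_contract1 winding_cons; congr (_ - _).
elim/bar_gen_ind: c => [|c d IHc IHd|t].
- by rewrite !raddf0 mul0rz mulr0 freegU0.
- by rewrite !raddfB /= mulrzBl IHc IHd mulrBr -freegUB.
by rewrite bar_consU degU mulr1 freegU_mulz intz [t]tuple0.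
Qed.

Definition red_winding (x : D 1) : int := winding (val x).
Fact red_winding_is_additive : zmod_morphism red_winding.
Proof. by move=> x y; rewrite /red_winding !raddfB. Qed.
HB.instance Definition _ :=
  GRing.isZmodMorphism.Build (D 1) int red_winding red_winding_is_additive.

Lemma red_winding_exact (x : D 1) :
  red_winding x = 0 -> exists u, red_bd u = x.
Proof.
move=> wx; exists (red (- bar_contract (val x))).
rewrite red_bdE raddfN /= winding_contract [winding _]wx freegU0 sub0r opprK.
exact: red_id.
Qed.

Lemma red_bd_exact n (x : D n.+2) : red_bd x = 0 -> exists u, red_bd u = x.
Proof.
move/(congr1 val) => /= dx; exists (red (- bar_contract (val x))).
have := bar_contractP (val x); rewrite dx raddf0 addr0 => e.
by rewrite red_bdE raddfN /= e opprK red_id.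
Qed.

Definition red_loop : D 1 := red (<< loop >> : C 1).

Lemma red_winding_loop : red_winding red_loop = 1.
Proof.
by rewrite /red_winding redE raddfB /= degU /winding !liftU !scale1r.
Qed.

(** * Homology of the invariant chains *)

Lemma reduced_homology_odd m :
  exists g, @twisted_generator (red_complex intG) red_flip false m.*2 g.
Proof.
apply: (@invariant_homology_odd (red_complex intG) red_flip _ _ _ _ _
  red_winding _ _ _ red_loop).
- exact: red_flipK.
- by move=> n x; apply: red_act_bd.
- exact: red_flip_exact.
- exact: red_bd_exact.
- exact: red_complex_bd0.
- by move=> u; apply: winding_bd.
- by move=> x; apply: winding_flip.
- exact: red_winding_exact.
- exact: red_winding_loop.
Qed.

Lemma reduced_homology_even m :
  @twisted_acyclic (red_complex intG) red_flip false m.*2.+1.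
Proof.
apply: (@invariant_homology_even (red_complex intG) red_flip _ _ _ _
  red_winding).
- exact: red_flipK.
- by move=> n x; apply: red_act_bd.
- exact: red_flip_exact.
- exact: red_bd_exact.
- by move=> u; apply: winding_bd.
- by move=> x; apply: winding_flip.
- exact: red_winding_exact.
Qed.

Local Notation tcycle := (@twisted_cycle (red_complex intG) red_flip false _).
Local Notation tbd := (@twisted_bd (red_complex intG) red_flip false _).
Local Notation I := (inv_bar_complex neg_aut_action).

Definition red_cycle n (z : Defs.cycle_group I n.+1) : D n.+1 :=
  red (val (val z)).

Fact red_cycle_is_additive n : zmod_morphism (@red_cycle n).
Proof. by move=> x y; rewrite /red_cycle !raddfB. Qed.
HB.instance Definition _ n :=
  GRing.isZmodMorphism.Build (Defs.cycle_group I n.+1) (D n.+1) (@red_cycle n)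
    (@red_cycle_is_additive n).

Lemma flip_inv n (c : I n) : flip (val c) = val c.
Proof. by apply/eqP; rewrite -invariantE; apply: inv_chainP. Qed.

Lemma bd_cycle n (z : Defs.cycle_group I n.+1) : bar_bd (val (val z)) = 0.
Proof. by case: z => z /= /eqP/(congr1 val). Qed.

Lemma red_cycleP n (z : Defs.cycle_group I n.+1) : tcycle (red_cycle z).
Proof.
split; first by rewrite /twist red_flipE flip_inv.
by rewrite [LHS]red_bdE bd_cycle raddf0.
Qed.

Lemma red_cycle_surj n (x : D n.+1) : tcycle x -> exists z, red_cycle z = x.
Proof.
move=> [/(congr1 val) fx /(congr1 val) dx].
have ix : val x \in @is_invariant _ _ neg_aut_action n.+1.
  by rewrite invariantE; apply/eqP.
have cx : InvChain ix \in @is_cycle I n.+1.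
  by apply/eqP/val_inj.
by exists (Cycle cx); apply: red_id.
Qed.

(** A cycle z differs from its reduction by deg z [0|...|0]. This is the
    boundary of a multiple of [0|...|0] if the number of entries is odd. If it
    is even and positive, then deg z = 0, because the coefficients of the
    boundary of z also sum to deg z. *)
Lemma is_boundary_red n (z : Defs.cycle_group I n.+1) :
  z \in @is_boundary I n.+1 <-> tbd (red_cycle z).
Proof.
split=> [/asboolP[u /(congr1 val) du] | [u fu du]].
  exists (red (val u)); first by rewrite /twist red_flipE flip_inv.
  by rewrite [LHS]red_bdE [bar_bd _]du.
pose X := val (val z).
pose v : C n.+2 := val u + << deg X *g unit_tuple intG n.+2 >>.
have iv : v \in @is_invariant _ _ neg_aut_action n.+2.
  rewrite invariantE raddfD /= [X in _ + X]bar_act_unit.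
  by rewrite -[X in _ == X + _](congr1 val fu).
apply/asboolP; exists (InvChain iv); apply: val_inj; rewrite /= raddfD /=.
rewrite [X in X + _](congr1 val du) redE bar_bd_unit.
have -> : (odd n.+1)%:Z * deg X = deg X.
  have := deg_bar_bd X; rewrite bd_cycle deg0 /=; case: odd; lia.
by rewrite subrK.
Qed.

End Flip.

(* 'Z_2 is the group with two elements and 'I_1 the trivial group. *)
Theorem theorem5p8 (i : nat) (hi : (0 < i)%N) :
  if odd i
  then zmod_isog (inv_homology neg_aut_action i) 'Z_2
  else zmod_isog (inv_homology neg_aut_action i) 'I_1.
Proof.
case: i hi => // n _ /=; rewrite -[n in inv_homology _ n.+1]odd_double_half.
case: (boolP (odd n)) => _ /=; set m := n./2.
  apply: quotient_trivial => z; apply/is_boundary_red.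
  exact/reduced_homology_even/red_cycleP.
have [x [cx nbx gen]] := reduced_homology_odd m.
have [g eg] := red_cycle_surj cx.
apply: (@quotient_order2 _ _ g).
  by apply/negP => /is_boundary_red; rewrite eg.
move=> z; have [b|b] := gen _ (red_cycleP z); [left|right].
  exact/is_boundary_red.
by apply/is_boundary_red; rewrite raddfB /= eg.
Qed.
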